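(* There exist absolute constants $\beta\in(0,1)$ and $c>0$ such that the following holds. Fix $a>0$, $\sigma>0$ and an integer $1\le r\le\min(m_1,m_2)$. Suppose that for some $0<\mu<\infty$ there exists a constant $\delta_r\in[0,1)$ such that $$(1-\delta_r)\|A\|_2\le\mu\|A\|_{L_2(\Pi)}\le(1+\delta_r)\|A\|_2$$ for all matrices $A\in\mathbb R^{m_1\times m_2}$ with rank at most $r$. Assume that $\mu^2r\le n\min(m_1,m_2)$ and that, conditionally on $X_i$, the variables $\xi_i=Y_i-\mathbb E(Y_i\mid X_i)$ are Gaussian $\mathcal N(0,\sigma^2)$, for $i=1,\dots,n$. Then, with $M=\max(m_1,m_2)$, $$\inf_{\hat A}\ \sup_{A_0\in\mathcal A(r,a)}\mathbb P_{A_0}\left(\|\hat A-A_0\|_{L_2(\Pi)}^2>c(1-\delta_r)^2(\sigma\wedge a)^2\,\frac{Mr}{n}\right)\ge\beta .$$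
   Context: Trace regression model: $(X_i,Y_i)$, $i=1,\dots,n$, are independent random pairs, where $X_i\in\mathbb R^{m_1\times m_2}$ has a given distribution $\Pi_i$ (not depending on $A_0$) and $\mathbb E(Y_i\mid X_i)=\langle A_0,X_i\rangle=\mathrm{tr}(A_0^\top X_i)$. $\mathbb P_A$ denotes the distribution of $(X_1,Y_1,\dots,X_n,Y_n)$ when $A_0=A$. $\|A\|_{L_2(\Pi)}^2=\frac1n\sum_{i=1}^n\mathbb E\langle A,X_i\rangle^2$; $\|\cdot\|_2$ is the Frobenius norm. $\sigma\wedge a=\min(\sigma,a)$. $\mathcal A(r,a)=\{A_0=(a_0(i,j))\in\mathbb R^{m_1\times m_2}:\mathrm{rank}(A_0)\le r,\ \max_{i,j}|a_0(i,j)|\le a\}$. $\inf_{\hat A}$ is the infimum over all estimators, i.e. measurable functions of $(X_1,Y_1,\dots,X_n,Y_n)$ with values in $\mathbb R^{m_1\times m_2}$. *)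

(* Defs.v *)
(* MathComp-Analysis, over an arbitrary realType R. *)
From HB Require Import structures.
From mathcomp Require Export all_boot all_order all_algebra.
From mathcomp Require Export all_classical all_reals all_analysis.

Set Implicit Arguments.
Unset Strict Implicit.
Unset Printing Implicit Defensive.

Import Order.TTheory GRing.Theory Num.Theory.

Local Open Scope classical_set_scope.
Local Open Scope ring_scope.

(* Matrix spaces carry the sigma-algebra generated by the entries (the product
   sigma-algebra, i.e. the Borel one over the reals), as the library does for
   tuples. *)
Definition measure_matrix_display : measure_display -> measure_display.
Proof. exact. Qed.

Section measurable_matrix.
Context d (T : measurableType d) (m1 m2 : nat).

Definition g_sigma_entries : set (set 'M[T]_(m1, m2)) :=
  <<s \bigcup_(ij in [set: 'I_m1 * 'I_m2])
        preimage_set_system setT (fun A : 'M[T]_(m1, m2) => A ij.1 ij.2)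
          measurable >>.

Let mx_set0 : g_sigma_entries set0.
Proof. exact: sigma_algebra0. Qed.

Let mx_setC A : g_sigma_entries A -> g_sigma_entries (~` A).
Proof. exact: sigma_algebraC. Qed.

Let mx_bigcup (F : (set 'M[T]_(m1, m2))^nat) :
  (forall i, g_sigma_entries (F i)) -> g_sigma_entries (\bigcup_i F i).
Proof. exact: sigma_algebra_bigcup. Qed.

HB.instance Definition _ := @isMeasurable.Build (measure_matrix_display d)
  'M[T]_(m1, m2) g_sigma_entries mx_set0 mx_setC mx_bigcup.

End measurable_matrix.

Section conditional_expectation.
Context d d' (Omega : measurableType d) (T : measurableType d') (R : realType).

(* g(X) is a version of the conditional expectation of Y given X. *)
Definition is_cond_expectation (P : probability Omega R) (X : Omega -> T)
    (Y : Omega -> R) (g : T -> R) : Prop :=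
  [/\ P.-integrable setT (EFin \o Y), measurable_fun setT g &
      forall B : set T, measurable B ->
        (\int[P]_(w in X @^-1` B) (Y w)%:E =
         \int[P]_(w in X @^-1` B) (g (X w))%:E)%E].

(* The conditional distribution of xi given X is the law Q, whatever the value
   of X. *)
Definition has_cond_distribution (P : probability Omega R) (X : Omega -> T)
    (xi : Omega -> R) (Q : set R -> \bar R) : Prop :=
  forall (B : set T) (C : set R), measurable B -> measurable C ->
    P (X @^-1` B `&` xi @^-1` C) = (P (X @^-1` B) * Q C)%E.

End conditional_expectation.

(* Mutual independence of the coordinates of a random tuple; letting some of
   the B i be the whole space gives the product rule for every subfamily. *)
Definition independent_coordinates d (T : measurableType d) (R : realType)
    (n : nat) (P : probability (n.-tuple T) R) : Prop :=
  forall B : 'I_n -> set T, (forall i, measurable (B i)) ->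
    P [set z | forall i, B i (tnth z i)] =
    (\prod_(i < n) P [set z | B i (tnth z i)])%E.

(* The sample space: its points are ((X_1, Y_1), ..., (X_n, Y_n)). *)
Notation sample R m1 m2 n := (n.-tuple ('M[R]_(m1, m2) * R)%type).

Section trace_regression.
Context (R : realType) (m1 m2 n : nat).
Implicit Types (A : 'M[R]_(m1, m2)) (Pi : 'I_n -> probability 'M[R]_(m1, m2) R).

Definition mxinner (A B : 'M[R]_(m1, m2)) : R := \tr (A^T *m B).

Definition frobenius A : R := Num.sqrt (\sum_i \sum_j A i j ^+ 2).

(* Only the marginal laws Pi i of the X_i matter.  The value is +oo when some
   second moment is infinite. *)
Definition L2Pi_sqnorm Pi A : \bar R :=
  ((n%:R^-1)%:E * \sum_(i < n) 'E_(Pi i)[fun x => (mxinner A x ^+ 2)%R])%E.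

Definition L2Pi_norm Pi A : \bar R := sqrte (L2Pi_sqnorm Pi A).

Definition restricted_isometry Pi (r : nat) (mu delta : R) : Prop :=
  forall A, (\rank A <= r)%N ->
    (((1 - delta) * frobenius A)%:E <= mu%:E * L2Pi_norm Pi A)%E /\
    (mu%:E * L2Pi_norm Pi A <= ((1 + delta) * frobenius A)%:E)%E.

Definition design (i : 'I_n) (z : sample R m1 m2 n) :
    'M[R]_(m1, m2) := (tnth z i).1.
Definition response (i : 'I_n) (z : sample R m1 m2 n) : R := (tnth z i).2.

(* P is the law of the sample in the model with regression matrix A. *)
Definition trace_regression_law Pi A
    (P : probability (sample R m1 m2 n) R) : Prop :=
  [/\ independent_coordinates P,
      forall i (B : set 'M[R]_(m1, m2)), measurable B ->
        P (design i @^-1` B) = Pi i B &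
      forall i, is_cond_expectation P (design i) (response i) (mxinner A)].

(* Y_i - E(Y_i | X_i), the conditional expectation being <A, X_i>. *)
Definition noise A (i : 'I_n) (z : sample R m1 m2 n) : R :=
  response i z - mxinner A (design i z).

(* normal_prob takes the standard deviation, not the variance. *)
Definition gaussian_noise A (sigma : R)
    (P : probability (sample R m1 m2 n) R) : Prop :=
  forall i, has_cond_distribution P (design i) (noise A i)
              (normal_prob 0 sigma).

Definition matrix_class (r : nat) (a : R) : set 'M[R]_(m1, m2) :=
  [set A | (\rank A <= r)%N /\ forall i j, `|A i j| <= a].

Definition estimator : set (sample R m1 m2 n -> 'M[R]_(m1, m2)) :=
  [set Ahat | measurable_fun setT Ahat].

End trace_regression.

(* Main.v *)
Require Import Defs.
From mathcomp Require Import ring lra measurable_realfun.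

Set Implicit Arguments.
Unset Strict Implicit.
Unset Printing Implicit Defensive.

Import Order.TTheory GRing.Theory Num.Theory.

Local Open Scope classical_set_scope.
Local Open Scope ring_scope.

(* Assouad's cube replaces Fano's inequality.  Index 2^(M r) matrices by bits
   w(i, l), i < M, l < r: the entry h w(i, l) is repeated over a block of
   minn m1 m2 %/ r positions, so that all matrices and their differences have
   rank at most r and the restricted isometry applies to them.  With
   h = min(sigma, a) * mu * sqrt (r / (n minn m1 m2)), flipping one bit leaves a
   Hellinger affinity at least 1/2 between the two sample laws, so no bit can
   be tested reliably and an estimate of w misses a constant fraction of the
   M r bits on average.  As the Hamming loss is at most M r, the average bound
   is also a bound in probability; it transfers to an arbitrary estimator of
   the matrix by the triangle inequality for the norm L_2(Pi). *)

(** * Testing two product measures *)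

Section amgm.
Context (R : realType).
Implicit Types (k u v : \bar R) (t a b : R).

(** For each fixed [t] the right side is linear in [u] and [v], so the inequality can be integrated
    without square roots, and infinite values are allowed. *)
Definition amgm k u v :=
  forall t, 0 < t -> (k <= t%:E * u + t^-1%:E * v)%E.

(** Substitute [t * a / b] for [t] and multiply by [a * b]. *)
Lemma amgm_scale a b k u v : 0 < a -> 0 < b -> (0 <= u)%E -> (0 <= v)%E ->
  amgm k u v ->
  amgm ((a * b)%:E * k)%E ((a ^+ 2)%:E * u)%E ((b ^+ 2)%:E * v)%E.
Proof.
move=> a0 b0 u0 v0 kuv t t0.
have s0 : 0 < t * a / b by rewrite divr_gt0// mulr_gt0.
have ab0 : 0 <= a * b by rewrite ltW// mulr_gt0.
have := kuv _ s0; rewrite -(@lee_pmul2l _ (a * b)%:E)//; last first.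
  by rewrite lte_fin mulr_gt0.
move=> /le_trans; apply.
rewrite ge0_muleDr; first last.
- by rewrite mule_ge0// lee_fin invr_ge0 ltW.
- by rewrite mule_ge0// lee_fin ltW.
rewrite !muleA -!EFinM.
rewrite (_ : a * b * (t * a / b) = t * a ^+ 2); last by field; lra.
rewrite (_ : a * b * (t * a / b)^-1 = t^-1 * b ^+ 2)//.
by field; lra.
Qed.

(** This plays the part of Cauchy-Schwarz: the inequality is integrated separately for each [t]. *)
Lemma amgm_integral d (T : measurableType d) (mu : {measure set T -> \bar R})
    (h f g : T -> \bar R) :
  measurable_fun setT h -> measurable_fun setT f -> measurable_fun setT g ->
  (forall x, 0 <= h x)%E -> (forall x, 0 <= f x)%E -> (forall x, 0 <= g x)%E ->
  (forall x, amgm (h x) (f x) (g x)) ->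
  amgm (\int[mu]_x h x)%E (\int[mu]_x f x)%E (\int[mu]_x g x)%E.
Proof.
move=> mh mf mg h0 f0 g0 hfg t t0.
have t0' : (0 <= t%:E)%E by rewrite lee_fin ltW.
have ti0 : (0 <= t^-1%:E)%E by rewrite lee_fin invr_ge0 ltW.
rewrite -!ge0_integralZl// -ge0_integralD//; first last.
- exact: measurable_funeM.
- by move=> x _; rewrite mule_ge0.
- exact: measurable_funeM.
- by move=> x _; rewrite mule_ge0.
apply: ge0_le_integral => //.
- by apply: emeasurable_funD; exact: measurable_funeM.
- by move=> x _; exact: hfg.
Qed.

End amgm.

Section affinity.
Context (R : realType).

(* A dual form of "the Hellinger affinity of P and Q is at least rho".  As
   amgm k u v means k <= 2 sqrt (u v), it reads: 2 sqrt (f g) >= k pointwise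
   implies 2 sqrt (P f * Q g) >= k rho.  Unlike the integral of sqrt (dP dQ) it
   needs no density, and it iterates through Fubini. *)
Definition affinity_ge d (T : measurableType d) (P Q : set T -> \bar R)
    (rho : R) :=
  forall (k : R) (f g : T -> \bar R), 0 <= k ->
    measurable_fun setT f -> measurable_fun setT g ->
    (forall x, 0 <= f x)%E -> (forall x, 0 <= g x)%E ->
    (forall x, amgm k%:E (f x) (g x)) ->
    amgm (k * rho)%:E (\int[P]_x f x)%E (\int[Q]_x g x)%E.

(** Le Cam's two-point bound. The indicators of [E] and its complement have product zero; adding
    [eta ^+ 2] to both makes the product at least [eta ^+ 2], so [k = 2 * eta] is admissible. The
    price is the term [2 * eta ^+ 2]. *)
Lemma affinity_test d (T : measurableType d) (P Q : probability T R)
    (rho eta : R) (E : set T) :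
  0 < eta -> measurable E -> affinity_ge P Q rho ->
  ((2 * eta * rho - 2 * eta ^+ 2)%:E <= P E + Q (~` E))%E.
Proof.
move=> e0 mE PQ.
pose f (z : T) : \bar R := (\1_E z + eta ^+ 2)%:E.
pose g (z : T) : \bar R := (\1_(~` E) z + eta ^+ 2)%:E.
have mf : measurable_fun setT f.
  by apply/measurable_EFinP; exact: measurable_funD.
have mCE := measurableC mE.
have mg : measurable_fun setT g.
  by apply/measurable_EFinP; exact: measurable_funD.
have int_indic (S : probability T R) (A : set T) : measurable A ->
    (\int[S]_z (\1_A z + eta ^+ 2)%:E = S A + (eta ^+ 2)%:E)%E.
  move=> mA; under eq_integral do rewrite EFinD.
  rewrite ge0_integralD//; first last.
  - by move=> x _; rewrite lee_fin sqr_ge0.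
  - by apply/measurable_EFinP.
  rewrite integral_indic// setIT integral_cst//.
  by rewrite [X in (_ * X)%E]probability_setT mule1.
have := PQ (2 * eta) f g _ mf mg _ _ _ 1 ltr01.
rewrite !int_indic// invr1 !mul1e => H.
have {}H : ((2 * eta * rho)%:E
    <= P E + (eta ^+ 2)%:E + (Q (~` E) + (eta ^+ 2)%:E))%E.
  apply: H; first by rewrite mulr_ge0// ltW.
  - by move=> x; rewrite lee_fin addr_ge0// sqr_ge0.
  - by move=> x; rewrite lee_fin addr_ge0// sqr_ge0.
  move=> x t t0; rewrite -!EFinM -EFinD lee_fin /f /g indicC.
  have amgm2 s : 0 < s -> 2 * eta <= s + s^-1 * eta ^+ 2.
    move=> s0; rewrite -subr_ge0.
    rewrite (_ : _ - _ = s^-1 * (s - eta) ^+ 2); last by field; lra.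
    by rewrite mulr_ge0// ?sqr_ge0// invr_ge0 ltW.
  have ti0 : 0 < t^-1 by rewrite invr_gt0.
  have te0 : 0 <= t * eta ^+ 2 by rewrite mulr_ge0// ?sqr_ge0// ltW.
  have tie0 : 0 <= t^-1 * eta ^+ 2 by rewrite mulr_ge0// ?sqr_ge0// ltW.
  have := amgm2 _ t0; have := amgm2 _ ti0; rewrite invrK => ? ?.
  rewrite !indicE; case: (x \in E) => /=; lra.
have PE : P E \is a fin_num by exact: fin_num_measure.
have QE : Q (~` E) \is a fin_num by exact: fin_num_measure.
move: H; rewrite -(fineK PE) -(fineK QE) -!EFinD !lee_fin; lra.
Qed.

(** With the first coordinate fixed, the second pair gives the pointwise hypothesis for the partial
    integrals with [k * rho2]; the first pair is then applied to these, and Tonelli concludes. *)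
Lemma affinity_prod d1 d2 (T1 : measurableType d1) (T2 : measurableType d2)
    (P1 Q1 : probability T1 R) (P2 Q2 : probability T2 R) (rho1 rho2 : R) :
  0 <= rho2 -> affinity_ge P1 Q1 rho1 -> affinity_ge P2 Q2 rho2 ->
  affinity_ge (P1 \x P2)%E (Q1 \x Q2)%E (rho1 * rho2).
Proof.
move=> rho20 PQ1 PQ2 k f g k0 mf mg f0 g0 kfg.
rewrite !fubini_tonelli1// mulrCA mulrC; apply: PQ1; first by rewrite mulr_ge0.
- exact: measurable_fun_fubini_tonelli_F.
- exact: measurable_fun_fubini_tonelli_F.
- by move=> x; exact: integral_ge0.
- by move=> x; exact: integral_ge0.
by move=> x; apply: PQ2 => //; exact: measurableT_comp.
Qed.

Lemma affinity_eq d (T : measurableType d)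
    (P Q P' Q' : {measure set T -> \bar R}) (rho : R) :
  (forall A, measurable A -> P A = P' A) ->
  (forall A, measurable A -> Q A = Q' A) ->
  affinity_ge P' Q' rho -> affinity_ge P Q rho.
Proof.
move=> PP' QQ' PQ k f g k0 mf mg f0 g0 kfg.
rewrite (eq_measure_integral P'); last by move=> A mA _; exact: PP'.
rewrite [X in amgm _ _ X](eq_measure_integral Q'); last first.
  by move=> A mA _; exact: QQ'.
exact: PQ.
Qed.

Lemma affinity_pushforward d1 d2 (T1 : measurableType d1)
    (T2 : measurableType d2) (P Q : {measure set T1 -> \bar R}) (rho : R)
    (phi : T1 -> T2) :
  measurable_fun setT phi -> affinity_ge P Q rho ->
  affinity_ge (pushforward P phi) (pushforward Q phi) rho.
Proof.
move=> mphi PQ k f g k0 mf mg f0 g0 kfg.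
rewrite (ge0_integral_pushforward mphi P measurableT mf (fun y _ => f0 y)).
rewrite (ge0_integral_pushforward mphi Q measurableT mg (fun y _ => g0 y)).
rewrite preimage_setT.
apply: PQ => //=.
- exact: (measurableT_comp mf mphi).
- exact: (measurableT_comp mg mphi).
Qed.

End affinity.

Section tuples.
Context (R : realType) d (T : measurableType d).

Lemma measurable_box n (B : 'I_n -> set T) : (forall i, measurable (B i)) ->
  measurable [set z : n.-tuple T | forall i, B i (tnth z i)].
Proof.
move=> mB.
rewrite (_ : mkset _ = \bigcap_(i in [set: 'I_n]) ((@tnth n T)^~ i @^-1` B i)).
  apply: fin_bigcap_measurable; first exact: finite_finset.
  by move=> i _; rewrite -[X in measurable X]setTI; exact: measurable_tnth.
by apply/seteqP; split => z /= zB i; [move=> _; exact: zB|exact: (zB i I)].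
Qed.

(** Boxes are stable under intersection and generate the sigma-algebra of tuples: a generating
    cylinder is a box with all sides but one equal to [setT]. *)
Lemma tuple_measure_unique n (P Q : probability (n.-tuple T) R) :
  (forall B : 'I_n -> set T, (forall i, measurable (B i)) ->
    P [set z | forall i, B i (tnth z i)] =
    Q [set z | forall i, B i (tnth z i)]) ->
  forall A, measurable A -> P A = Q A.
Proof.
move=> PQ A mA.
pose G := [set [set z : n.-tuple T | forall i, B i (tnth z i)] |
  B in [set B : 'I_n -> set T | forall i, measurable (B i)]].
have GT : G setT.
  exists (fun=> setT) => //=.
  by apply/seteqP; split => z.
apply: (measure_unique G (fun=> setT)) => //.
- apply/seteqP; split; last first.
    apply: smallest_sub; first exact: sigma_algebra_measurable.
    by move=> _ [B mB <-]; exact: measurable_box.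
  apply: smallest_sub; first exact: smallest_sigma_algebra.
  elim/big_ind : _ => //; first by move=> ? ? ? ?; rewrite subUset.
  move=> i _ _ [B mB <-]; apply: sub_sigma_algebra.
  exists (fun j => if j == i then B else setT).
    by move=> j /=; case: ifP.
  rewrite setTI; apply/seteqP; split => z /=; first by move/(_ i); rewrite eqxx.
  by move=> zB j; case: eqP => // ->.
- move=> _ _ [B mB <-] [C mC <-]; exists (fun i => B i `&` C i).
    by move=> i; exact: measurableI.
  apply/seteqP; split => z /=; last by move=> [zB zC] i.
  by move=> zBC; split => i; case: (zBC i).
- exact: bigcup_const.
- by move=> _ [B mB <-]; exact: PQ.
- by move=> k; rewrite [ltLHS]probability_setT ltry.
Qed.

Definition push d' (T' : measurableType d') (P : probability T' R)
    (f : T' -> T) (mf : measurable_fun setT f) : probability T R :=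
  distribution P (mfun_Sub (mem_set mf)).

End tuples.

(** Induction on [n]: by independence, the law of a tuple is the image under [phi] of the product of
    the law of its head and the law of its tail, and the tail again has independent coordinates. *)
Lemma affinity_tuple (R : realType) d (T : measurableType d) n
    (P Q : probability (n.-tuple T) R) (rho : 'I_n -> R) :
  (forall i, 0 <= rho i) ->
  independent_coordinates P -> independent_coordinates Q ->
  (forall i, affinity_ge (pushforward P (@tnth n T ^~ i))
                         (pushforward Q (@tnth n T ^~ i)) (rho i)) ->
  affinity_ge P Q (\prod_(i < n) rho i).
Proof.
elim: n => [|n IHn] in P Q rho * => rho0 iP iQ PQ.
  (* The only probability on empty tuples is the Dirac mass at [[tuple]]. *)
  have Pt (S : probability (0.-tuple T) R) (f : 0.-tuple T -> \bar R) :
      (\int[S]_x f x = f [tuple])%E.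
    rewrite (eq_integral (cst (f [tuple]))) => [|x _]; last by rewrite tuple0.
    by rewrite integral_cst// [X in (_ * X)%E]probability_setT mule1.
  move=> k f g k0 mf mg f0 g0 kfg; rewrite !Pt big_ord0 mulr1; exact: kfg.
have mh := @measurable_tnth _ T n.+1 ord0.
have mt := @measurable_behead _ T n.
pose phi (x : T * n.-tuple T) := [tuple of x.1 :: x.2].
have mphi : measurable_fun setT phi by exact: measurable_cons.
have head_beheadE (z : n.+1.-tuple T) i :
    tnth z (lift ord0 i) = tnth [tuple of behead z] i.
  by rewrite [in LHS](tuple_eta z) tnthS.
have boxE (B : 'I_n.+1 -> set T) :
    [set z : n.+1.-tuple T | forall i, B i (tnth z i)] =
    [set z | B ord0 (tnth z ord0) /\
      forall i, B (lift ord0 i) (tnth [tuple of behead z] i)].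
  apply/seteqP; split => z /=.
    by move=> zB; split => // i; rewrite -head_beheadE; exact: zB.
  move=> [z0 zS] i; case: (unliftP ord0 i) => [j ->|-> //].
  by rewrite head_beheadE; exact: zS.
have iT (S : probability (n.+1.-tuple T) R) (B : 'I_n -> set T) :
    independent_coordinates S -> (forall i, measurable (B i)) ->
    S [set z : n.+1.-tuple T | forall i, B i (tnth [tuple of behead z] i)] =
    (\prod_(i < n) S [set z | B i (tnth z (lift ord0 i))])%E.
  (* Giving the head the whole space as its side turns the product rule for [n.+1] coordinates into
     the one for the tail. *)
  move=> iS mB; pose B' i := oapp B setT (unlift ord0 i).
  have mB' i : measurable (B' i) by rewrite /B'; case: unliftP => /=.
  have := iS _ mB'; rewrite boxE big_ord_recl /=.
  have B'S i : B' (lift ord0 i) = B i by rewrite /B' liftK.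
  rewrite /B' unlift_none /=.
  under eq_bigr do rewrite -/(B' _) B'S.
  rewrite (_ : [set _ | True] = setT) ?probability_setT ?mul1e; last first.
    by apply/seteqP; split.
  move=> <-; congr (S _); apply/seteqP; split => z /=.
  - by move=> zB; split => // i; rewrite -/(B' _) B'S.
  - by move=> [_ zB] i; have := zB i; rewrite -/(B' _) B'S.
have indepT (S : probability (n.+1.-tuple T) R) : independent_coordinates S ->
    independent_coordinates (push S mt).
  move=> iS B mB; rewrite [LHS](iT S B iS mB); apply: eq_bigr => i _.
  by congr (S _); apply/seteqP; split => z /=; rewrite head_beheadE.
have consE (S : probability (n.+1.-tuple T) R) : independent_coordinates S ->
    forall A, measurable A ->
      S A = push (push S mh \x push S mt)%E mphi A.
  move=> iS; apply: tuple_measure_unique => B mB.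
  rewrite iS// big_ord_recl -(iT S (fun i => B (lift ord0 i)))//.
  transitivity ((push S mh \x push S mt)%E (B ord0 `*`
      [set z : n.-tuple T | forall i, B (lift ord0 i) (tnth z i)])).
    have mbox := measurable_box (fun i => mB (lift ord0 i)).
    by rewrite product_measure1E.
  rewrite -[RHS]/((push S mh \x push S mt)%E (phi @^-1`
    [set z : n.+1.-tuple T | forall i, B i (tnth z i)])); congr (_ _).
  apply/seteqP; split => -[x z] /=.
    move=> [Bx Bz] i; case: (unliftP ord0 i) => [j ->|-> //].
    by rewrite tnthS.
  move=> Bxz; split; first exact: (Bxz ord0).
  by move=> i; have := Bxz (lift ord0 i); rewrite tnthS.
apply: affinity_eq (consE _ iP) (consE _ iQ) _.
apply: (affinity_pushforward mphi).
rewrite big_ord_recl; apply: affinity_prod.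
- exact: prodr_ge0.
- exact: PQ.
- apply: IHn => //; [exact: indepT|exact: indepT|move=> i].
  have := PQ (lift ord0 i).
  rewrite (_ : (@tnth n.+1 T)^~ (lift ord0 i) =
    fun z => tnth [tuple of behead z] i)//.
  by apply/funext => z; exact: head_beheadE.
Qed.

(** * Gaussian regression *)

Section gaussian.
Context (R : realType).
Local Notation leb := (@lebesgue_measure R).

Import HBNNSimple.

(** True for indicators by hypothesis, hence for simple functions by linearity, and in general by
    monotone convergence along [nnsfun_approx]. *)
Lemma ge0_integral_density d (T : measurableType d)
    (mu nu : {measure set T -> \bar R}) (p : T -> R) (f : T -> \bar R) :
  measurable_fun setT p -> (forall x, 0 <= p x) ->
  (forall A, measurable A -> nu A = (\int[mu]_(x in A) (p x)%:E)%E) ->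
  measurable_fun setT f -> (forall x, 0 <= f x)%E ->
  (\int[nu]_x f x = \int[mu]_x (f x * (p x)%:E))%E.
Proof.
move=> mp p0 nuE mf f0.
have mpE : measurable_fun setT (EFin \o p) by exact/measurable_EFinP.
pose f_ := nnsfun_approx measurableT mf.
transitivity (limn (fun n => \int[nu]_x (f_ n x)%:E))%E.
  rewrite -monotone_convergence//.
  - apply: eq_integral => y _; apply/esym/cvg_lim => //.
    by apply: cvg_nnsfun_approx=> // *; exact: f0.
  - by move=> n; exact/measurable_EFinP/measurable_funP.
  - by move=> n y _; rewrite lee_fin.
  - by move=> y _ m n mn; rewrite lee_fin; exact/lefP/nd_nnsfun_approx.
rewrite [X in limn X](_ : _ =
    (fun n => \int[mu]_x ((f_ n x)%:E * (p x)%:E))%E).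
  rewrite -monotone_convergence//.
  - apply: eq_integral => y _; apply/cvg_lim => //.
    apply: cvgeZr => //.
    by apply: cvg_nnsfun_approx=> // *; exact: f0.
  - move=> n; apply: emeasurable_funM => //.
    exact/measurable_EFinP/measurable_funP.
  - by move=> n y _; rewrite mule_ge0// lee_fin.
  - move=> y _ m n mn; rewrite lee_pmul// ?lee_fin//.
    exact/lefP/nd_nnsfun_approx.
apply/funext => n.
have mset k : measurable (f_ n @^-1` [set k]) by [].
transitivity (\sum_(k \in range (f_ n)) (k%:E * nu (f_ n @^-1` [set k])))%E.
  by rewrite integralT_nnsfun sintegralE.
transitivity (\int[mu]_x (\sum_(k \in range (f_ n))
    (k * \1_(f_ n @^-1` [set k]) x)%:E * (p x)%:E))%E; last first.
  apply: eq_integral => x _; rewrite [in RHS]fimfunE -fsumEFin//.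
  by rewrite ge0_mule_fsuml// => k; exact: nnfun_muleindic_ge0.
rewrite ge0_integral_fsum//; last 2 first.
- move=> k; apply: emeasurable_funM => //.
  by apply/measurable_EFinP; exact: measurable_funM.
- move=> k x _; rewrite mule_ge0 ?lee_fin//.
  by have := nnfun_muleindic_ge0 (f_ n) k x; rewrite -EFinM lee_fin.
apply: eq_fsbigr => k; rewrite inE => -[x _ <-{k}].
under eq_integral do rewrite EFinM -muleA.
rewrite ge0_integralZl//; first last.
- by rewrite lee_fin.
- by move=> y _; rewrite mule_ge0 ?lee_fin.
- apply: emeasurable_funM => //; exact/measurable_EFinP.
rewrite nuE// integral_mkcond; congr (_ * _)%E.
apply: eq_integral => y _; rewrite patchE indicE.
by case: (y \in _); rewrite ?mul1e ?mul0e.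
Qed.

Lemma lebesgue_measure_shift (m : R) (A : set R) : measurable A ->
  pushforward leb (+%R^~ m : measurableTypeR R -> measurableTypeR R) A = leb A.
Proof.
move=> mA; apply/esym/lebesgue_measure_unique => //=.
  exact: (@measurable_funD _ _ R setT id (cst m)).
move=> _ _ [[a b]] _ <-.
rewrite /pushforward.
rewrite (_ : _ @^-1` _ = `]a - m, b - m]%classic); last first.
  by apply/seteqP; split => x /=; rewrite !in_itv/= ltrBlDr lerBrDr.
rewrite !lebesgue_measure_itv/= !lte_fin ltrD2r.
by case: ifP => // _; rewrite -!EFinD; congr EFin; ring.
Qed.

Let measurable_to_R :
  measurable_fun setT (fun x : measurableTypeR R => x : R).
Proof. by move=> _ A mA; rewrite setTI. Qed.

(* normal_prob is a measure on measurableTypeR R, whose display differs from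
   the one of R. *)
Definition gaussian (s : R) : probability R R :=
  push (normal_prob 0 s) measurable_to_R.

Lemma ge0_integral_gaussian s (f : R -> \bar R) :
  measurable_fun setT f -> (forall x, 0 <= f x)%E ->
  (\int[gaussian s]_x f x = \int[normal_prob 0 s]_x f x)%E.
Proof.
move=> mf f0.
have := ge0_integral_pushforward measurable_to_R (normal_prob 0 s) measurableT
  mf (fun x _ => f0 x).
by rewrite preimage_setT.
Qed.

(** Moves the mean from the integrand into the density, so that Gaussians with different means are
    compared over the same Lebesgue measure. *)
Lemma gaussian_shift (m s : R) (f : R -> \bar R) :
  s != 0 -> measurable_fun setT f -> (forall x, 0 <= f x)%E ->
  (\int[gaussian s]_x f (x + m)%R =
   \int[leb]_x (f x * (normal_pdf m s x)%:E))%E.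
Proof.
move=> s0 mf f0.
have mphi : measurable_fun setT
    (+%R^~ m : measurableTypeR R -> measurableTypeR R).
  exact: (@measurable_funD _ _ R setT id (cst m)).
rewrite ge0_integral_gaussian//; last first.
  exact: (measurableT_comp mf mphi).
rewrite (@ge0_integral_density _ _ leb _ (normal_pdf 0 s)); first last.
- by move=> x; exact: f0.
- exact: (measurableT_comp mf mphi).
- by move=> A _.
- exact: normal_pdf_ge0.
- exact: measurable_normal_pdf.
pose g x := (f x * (normal_pdf m s x)%:E)%E.
have mg : measurable_fun setT g.
  apply: emeasurable_funM => //; apply/measurable_EFinP.
  exact: measurable_normal_pdf.
have g0 x : (0 <= g x)%E by rewrite mule_ge0// lee_fin normal_pdf_ge0.
have := ge0_integral_pushforward mphi leb measurableT mg (fun y _ => g0 y).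
rewrite preimage_setT => gE.
transitivity (\int[leb]_x g (x + m)%R)%E.
  apply: eq_integral => x _; rewrite /g !normal_pdfE//.
  by rewrite /normal_fun subr0 addrK.
rewrite -[LHS]gE; apply: eq_measure_integral => A mA _.
exact: lebesgue_measure_shift.
Qed.

(** Completing the square: [(x - m)^2 + (x - m')^2] equals
    [2 (x - (m + m') / 2)^2 + (m - m')^2 / 2]. The exponential factor is the Hellinger affinity of
    the two Gaussians. *)
Lemma normal_pdf_midpoint (m m' s x : R) : s != 0 ->
  Num.sqrt (normal_pdf m s x) * Num.sqrt (normal_pdf m' s x) =
  expR (- (m - m') ^+ 2 / (8 * s ^+ 2)) * normal_pdf ((m + m') / 2) s x.
Proof.
move=> s0; rewrite -sqrtrM ?normal_pdf_ge0// !normal_pdfE//.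
set q := expR (- (m - m') ^+ 2 / (8 * s ^+ 2)).
rewrite [X in Num.sqrt X](_ : _ =
  (q * (normal_peak s * normal_fun ((m + m') / 2) s x)) ^+ 2).
  by rewrite sqrtr_sqr ger0_norm// !mulr_ge0 ?expR_ge0 ?normal_peak_ge0.
rewrite mulrACA [RHS]exprMn [X in _ = _ * X]exprMn [RHS]mulrCA -expr2.
congr (_ * _); rewrite /normal_fun /q -!expRM_natl -!expRD; congr expR.
by field.
Qed.

(** Scale the pointwise inequality by the square roots of the two densities and integrate; the left
    side becomes a constant times the density at the midpoint, whose integral is 1. *)
Lemma amgm_normal (m m' s k : R) (f g : R -> \bar R) : s != 0 -> 0 <= k ->
  measurable_fun setT f -> measurable_fun setT g ->
  (forall x, 0 <= f x)%E -> (forall x, 0 <= g x)%E ->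
  (forall x, amgm k%:E (f x) (g x)) ->
  amgm (k * expR (- (m - m') ^+ 2 / (8 * s ^+ 2)))%:E
    (\int[gaussian s]_x f (x + m)%R)%E
    (\int[gaussian s]_x g (x + m')%R)%E.
Proof.
move=> s0 k0 mf mg f0 g0 kfg; rewrite !gaussian_shift//.
set q := expR _; pose p x := k * q * normal_pdf ((m + m') / 2) s x.
have mp : measurable_fun setT (EFin \o p).
  apply/measurable_EFinP; apply: measurable_funM => //.
  exact: measurable_normal_pdf.
have kq0 : 0 <= k * q by rewrite mulr_ge0// expR_ge0.
have -> : (k * q)%:E = (\int[leb]_x (p x)%:E)%E.
  under eq_integral do rewrite EFinM.
  rewrite ge0_integralZl ?integral_normal_pdf ?mule1//.
  - by apply/measurable_EFinP; exact: measurable_normal_pdf.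
  - by move=> x _; rewrite lee_fin normal_pdf_ge0.
apply: amgm_integral => //.
- apply: emeasurable_funM => //; apply/measurable_EFinP.
  exact: measurable_normal_pdf.
- apply: emeasurable_funM => //; apply/measurable_EFinP.
  exact: measurable_normal_pdf.
- by move=> x; rewrite lee_fin mulr_ge0// normal_pdf_ge0.
- by move=> x; rewrite mule_ge0// lee_fin normal_pdf_ge0.
- by move=> x; rewrite mule_ge0// lee_fin normal_pdf_ge0.
have pdf_gt0 a x : 0 < normal_pdf a s x.
  by rewrite normal_pdfE// mulr_gt0 ?expR_gt0 ?normal_peak_gt0.
move=> x; have := @amgm_scale _ (Num.sqrt (normal_pdf m s x))
  (Num.sqrt (normal_pdf m' s x)) _ _ _ _ _ _ _ (kfg x).
rewrite normal_pdf_midpoint// -/q !sqr_sqrtr ?normal_pdf_ge0//.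
rewrite !sqrtr_gt0 -EFinM => /(_ (pdf_gt0 _ _) (pdf_gt0 _ _) (f0 x) (g0 x)).
rewrite (muleC (f x)) (muleC (g x)).
by rewrite (_ : _ * k = p x)// /p [RHS]mulrC mulrA mulrC mulrA.
Qed.

End gaussian.

Section regression.
Context (R : realType) d (T : measurableType d).
Variables (Pi : probability T R) (s : R).
Hypothesis s0 : s != 0.

(** Only rectangles in the pair (design, noise) are prescribed, as in [has_cond_distribution]; they
    suffice to determine [S]. *)
Definition regression_law (l : T -> R) (S : {measure set (T * R) -> \bar R}) :=
  forall B C, measurable B -> measurable C ->
    S [set z | B z.1 /\ C (z.2 - l z.1)] = (Pi B * normal_prob 0 s C)%E.

(** The shear [psi] carries [S] to a measure that agrees with [Pi \x gaussian s] on rectangles,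
    hence equals it. As [phi] undoes [psi], Tonelli gives the iterated integral. *)
Lemma regression_integral l S (f : T * R -> \bar R) :
  measurable_fun setT l -> regression_law l S ->
  measurable_fun setT f -> (forall z, 0 <= f z)%E ->
  (\int[S]_z f z =
   \int[Pi]_x \int[gaussian s]_e f (x, e + l x)%R)%E.
Proof.
move=> ml lS mf f0.
pose psi (z : T * R) := (z.1, z.2 - l z.1).
pose phi (z : T * R) := (z.1, z.2 + l z.1).
have mpsi : measurable_fun setT psi.
  apply: measurable_fun_pair => //; apply: measurable_funB => //.
  exact: measurableT_comp.
have mphi : measurable_fun setT phi.
  apply: measurable_fun_pair => //; apply: measurable_funD => //.
  exact: measurableT_comp.
have mfphi : measurable_fun setT (f \o phi) by exact: measurableT_comp.
have := ge0_integral_pushforward mpsi S measurableT mfphi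
  (fun z _ => f0 (phi z)).
rewrite preimage_setT => fE.
transitivity (\int[S]_z ((f \o phi) \o psi) z)%E.
  apply: eq_integral => -[x y] _.
  by rewrite /psi /phi /= subrK.
rewrite -[LHS]fE.
transitivity (\int[Pi \x gaussian s]_z (f \o phi) z)%E.
  apply: eq_measure_integral => A mA _; apply/esym.
  by apply: (product_measure_unique (m' := pushforward S psi)).
rewrite (fubini_tonelli1 (f \o phi)) //.
by move=> z; exact: f0.
Qed.

(** The Hellinger affinity of the two joint laws: the affinity of the conditional Gaussians,
    averaged over the design. The integral is at most 1, so [fine] loses nothing. *)
Definition regression_affinity (l l' : T -> R) : R :=
  fine (\int[Pi]_x (expR (- (l x - l' x) ^+ 2 / (8 * s ^+ 2)))%:E)%E.

Section measurable.
Variables l l' : T -> R.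
Hypotheses (ml : measurable_fun setT l) (ml' : measurable_fun setT l').

Let e x := expR (- (l x - l' x) ^+ 2 / (8 * s ^+ 2)).

Let me : measurable_fun setT (EFin \o e).
Proof.
apply/measurable_EFinP; apply: measurableT_comp => //.
apply: measurable_funM => //; apply: measurableT_comp => //.
by apply: measurable_funX; exact: measurable_funB.
Qed.

Let e_le1 x : e x <= 1.
Proof.
by rewrite /e -expR0 ler_expR mulNr oppr_le0 mulr_ge0 ?sqr_ge0// invr_ge0
  mulr_ge0 ?sqr_ge0.
Qed.

Let int_e_le1 : (\int[Pi]_x (e x)%:E <= 1)%E.
Proof.
rewrite -(@probability_setT _ _ _ Pi) -[leRHS]mul1e -integral_cst//.
apply: ge0_le_integral => //.
- by move=> x _; rewrite lee_fin expR_ge0.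
- by move=> x _; rewrite lee_fin.
Qed.

Lemma regression_affinityE :
  (regression_affinity l l')%:E = (\int[Pi]_x (e x)%:E)%E.
Proof.
rewrite /regression_affinity fineK// ge0_fin_numE; last first.
  by apply: integral_ge0 => x _; rewrite lee_fin expR_ge0.
by rewrite (le_lt_trans int_e_le1)// ltry.
Qed.

Lemma regression_affinity_ge0 : 0 <= regression_affinity l l'.
Proof.
by rewrite fine_ge0//; apply: integral_ge0 => x _; rewrite lee_fin expR_ge0.
Qed.

Lemma regression_affinity_le1 : regression_affinity l l' <= 1.
Proof. by rewrite -lee_fin regression_affinityE. Qed.

(** Integrate [1 - u <= expR (- u)]. Written as a sum, the bound also makes sense when the second
    moment is infinite. *)
Lemma regression_affinity_lb :
  (1 <= (regression_affinity l l')%:E +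
    (8 * s ^+ 2)^-1%:E * \int[Pi]_x ((l x - l' x) ^+ 2)%:E)%E.
Proof.
have md : measurable_fun setT (fun x => ((l x - l' x) ^+ 2)%:E).
  by apply/measurable_EFinP/measurable_funX; exact: measurable_funB.
have s8 : 0 <= (8 * s ^+ 2)^-1 by rewrite invr_ge0 mulr_ge0 ?sqr_ge0.
rewrite regression_affinityE -ge0_integralZl//; last first.
  by move=> x _; rewrite lee_fin sqr_ge0.
rewrite -ge0_integralD//; first last.
- exact: measurable_funeM.
- by move=> x _; rewrite mule_ge0// lee_fin// sqr_ge0.
- by move=> x _; rewrite lee_fin expR_ge0.
rewrite -[leLHS](@probability_setT _ _ _ Pi) -[leLHS]mul1e -integral_cst//.
apply: ge0_le_integral => //.
  by apply: emeasurable_funD => //; exact: measurable_funeM.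
move=> x _; rewrite lee_fin.
have := expR_ge1Dx (- (l x - l' x) ^+ 2 / (8 * s ^+ 2)).
by rewrite -/(e x); lra.
Qed.

(** [amgm_normal] at each design point, then [amgm_integral] over the design. *)
Lemma affinity_regression S S' : regression_law l S -> regression_law l' S' ->
  affinity_ge S S' (regression_affinity l l').
Proof.
move=> lS lS' k f g k0 mf mg f0 g0 kfg.
rewrite (regression_integral ml lS)// (regression_integral ml' lS')//.
have -> : (k * regression_affinity l l')%:E = (\int[Pi]_x (k * e x)%:E)%E.
  under eq_integral do rewrite EFinM.
  rewrite ge0_integralZl ?EFinM ?regression_affinityE//.
  by move=> x _; rewrite lee_fin expR_ge0.
have mF (h : T * R -> \bar R) (q : T -> R) : measurable_fun setT h ->
    measurable_fun setT q -> (forall z, 0 <= h z)%E ->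
    measurable_fun setT (fun x => \int[gaussian s]_y h (x, y + q x)%R)%E.
  move=> mh mq h0.
  apply: (@measurable_fun_fubini_tonelli_F _ _ _ _ _ (gaussian s)
    (fun z : T * R => h (z.1, z.2 + q z.1))) => //.
  apply: (measurableT_comp mh).
  apply: measurable_fun_pair => //; apply: measurable_funD => //.
  exact: measurableT_comp.
apply: amgm_integral.
- by under eq_fun do rewrite EFinM; exact: measurable_funeM.
- exact: mF.
- exact: mF.
- by move=> x; rewrite lee_fin mulr_ge0// expR_ge0.
- by move=> x; exact: integral_ge0.
- by move=> x; exact: integral_ge0.
move=> x.
apply: (@amgm_normal _ _ _ _ _ (fun y => f (x, y)) (fun y => g (x, y))) => //.
- exact: measurableT_comp.
- exact: measurableT_comp.
Qed.

End measurable.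
End regression.

(** * Assouad's lemma *)

Section assouad.
Context (R : realType) (J : finType) d (T : measurableType d).
Implicit Types w : {ffun J -> bool}.

Definition hamming w w' : nat := \sum_j (w j != w' j).

Definition flip (j : J) w : {ffun J -> bool} :=
  [ffun i => if i == j then ~~ w i else w i].

Lemma flipK j : involutive (flip j).
Proof.
by move=> w; apply/ffunP => i; rewrite !ffunE; case: eqP => // _; exact: negbK.
Qed.

Lemma hamming_flip j w : hamming w (flip j w) = 1%N.
Proof.
rewrite /hamming (bigD1 j)//= ffunE eqxx big1 ?addn0; first by case: (w j).
by move=> i ij; rewrite ffunE (negPf ij) eqxx.
Qed.

Variable P : {ffun J -> bool} -> probability T R.

(** Average over the cube: [flip j] permutes it, so each error probability can be paired with that
    of the flipped vertex, and each pair sums to at least [eta]. Some vertex is at least as bad as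
    the average. *)
Lemma assouad (eta : R) (test : T -> {ffun J -> bool}) :
  (forall j, measurable [set z | test z j]) ->
  (forall w j E, measurable E -> (eta%:E <= P w E + P (flip j w) (~` E))%E) ->
  exists w, ((eta / 2 * #|J|%:R)%:E <=
    \sum_j P w [set z | test z j != w j])%E.
Proof.
move=> mt PP; apply: contrapT => /forallNP noP.
have mtw j w : measurable [set z | test z j != w j].
  case: (w j).
    rewrite (_ : mkset _ = ~` [set z | test z j]); first exact: measurableC.
    by apply/seteqP; split => z /=; case: (test z j).
  rewrite (_ : mkset _ = [set z | test z j]) => //.
  by apply/seteqP; split => z /=; case: (test z j).
pose p w j := fine (P w [set z | test z j != w j]).
have pE w j : (p w j)%:E = P w [set z | test z j != w j].
  by rewrite fineK// fin_num_measure.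
have lt_p w : \sum_j p w j < eta / 2 * #|J|%:R.
  have := noP w; rewrite (eq_bigr (fun j => (p w j)%:E)) => [|j _//].
  by rewrite sumEFin lee_fin => /negP; rewrite -ltNge.
(* Guessing bit [j] right under [w] is guessing it wrong under [flip j w]. *)
have ge_p w j : eta <= p w j + p (flip j w) j.
  have := PP w j _ (mtw j w); rewrite -lee_fin EFinD !pE.
  rewrite (_ : ~` _ = [set z | test z j != flip j w j])//.
  apply/seteqP; split => z /=; rewrite ffunE eqxx.
    by case: (test z j); case: (w j).
  by case: (test z j); case: (w j).
have : \sum_w \sum_j p w j < \sum_(w : {ffun J -> bool}) (eta / 2 * #|J|%:R).
  by apply: ltr_sum => //; apply/hasP; exists [ffun=> true].
apply/negP; rewrite -leNgt.
have flipE : \sum_w \sum_j p w j = \sum_w \sum_j p (flip j w) j.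
  rewrite exchange_big [RHS]exchange_big; apply: eq_bigr => j _.
  by rewrite (reindex_inj (inv_inj (flipK j))).
have -> : \sum_w \sum_j p w j =
    2^-1 * \sum_w \sum_j (p w j + p (flip j w) j).
  under [in RHS]eq_bigr do rewrite big_split/=.
  by rewrite big_split/= -flipE; field.
rewrite big_distrr/=; apply: ler_sum => w _.
rewrite mulrAC [leLHS]mulrC ler_pM2l ?invr_gt0// mulr_natr -sumr_const.
by apply: ler_sum => j _; exact: ge_p.
Qed.

(* The estimator of w picks some w whose set S w contains the observation. *)
Lemma assouad_cover (eta : R) (S : {ffun J -> bool} -> set T) :
  0 < eta -> (0 < #|J|)%N -> (forall w, measurable (S w)) ->
  (forall z w w', S w z -> S w' z ->
    (hamming w w')%:R <= eta / 4 * #|J|%:R) ->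
  (forall w j E, measurable E -> (eta%:E <= P w E + P (flip j w) (~` E))%E) ->
  exists w, ((eta / 4)%:E <= P w (~` S w))%E.
Proof.
move=> e0 J0 mS SS PP.
pose b z := [ffun w => `[< S w z >]].
pose test z := odflt [ffun=> true] [pick w | b z w].
(* [b z] takes finitely many values, so an event depending on it alone is a finite union of finite
   intersections of sets [S w] and their complements. *)
have mb (Q : {ffun {ffun J -> bool} -> bool} -> bool) :
    measurable [set z | Q (b z)].
  rewrite (_ : mkset _ = \bigcup_(c in [set c | Q c])
      \bigcap_(w in [set: {ffun J -> bool}]) [set z | b z w = c w]).
    apply: fin_bigcup_measurable; first exact: finite_finset.
    move=> c _; apply: fin_bigcap_measurable; first exact: finite_finset.
    move=> w _; case: (c w).
      rewrite (_ : mkset _ = S w) //; apply/seteqP; split => z /=.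
        by rewrite ffunE => /asboolP.
      by rewrite ffunE => ?; apply/asboolP.
    rewrite (_ : mkset _ = ~` S w); first exact: measurableC.
    apply/seteqP; split => z /=; rewrite ffunE.
      by move/asboolPn.
    by move=> ?; apply/asboolPn.
  apply/seteqP; split => z /=; first by move=> Qb; exists (b z).
  move=> [c /= Qc bc]; suff -> : b z = c by [].
  by apply/ffunP => w; exact: bc.
have mt j : measurable [set z | test z j].
  exact: (mb (fun c => odflt [ffun=> true] [pick w | c w] j)).
have mtw j w : measurable [set z | test z j != w j].
  exact: (mb (fun c => odflt [ffun=> true] [pick w | c w] j != w j)).
have [w Hw] := assouad mt PP; exists w.
have mCS := measurableC (mS w).
have J0' : 0 < #|J|%:R :> R by rewrite ltr0n.
(* On [S w] the picked vertex is close to [w]; off [S w], where the default value may occur, the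
   loss is at most [#|J|]. Integrating and comparing with the mean loss [eta / 2 * #|J|] leaves
   [eta / 4] for the complement. *)
have testS z : (\sum_j \1_[set z | test z j != w j] z <=
    eta / 4 * #|J|%:R + #|J|%:R * \1_(~` S w) z :> R).
  have -> : \sum_j \1_[set z | test z j != w j] z =
      (hamming (test z) w)%:R :> R.
    rewrite natr_sum; apply: eq_bigr => j _; rewrite indicE.
    congr (nat_of_bool _)%:R.
    by apply/idP/idP => [/set_mem|h] //; exact/mem_set.
  have [zS|zS] := pselect (S w z).
    rewrite [X in _ + _ * X]indicE memNset ?mulr0 ?addr0; last first.
      by move=> /(_ zS).
    apply: (SS z) => //; rewrite /test; case: pickP => [w'|/(_ w)].
      by rewrite ffunE => /asboolP.
    by rewrite ffunE => /asboolP.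
  rewrite [X in _ + _ * X]indicE mem_set// mulr1.
  rewrite (@le_trans _ _ #|J|%:R)// ?lerDr.
    rewrite ler_nat /hamming -sum1_card; apply: leq_sum => j _.
    by case: (_ != _).
  by rewrite mulr_ge0 ?divr_ge0// ltW.
have : (\int[P w]_z (\sum_j \1_[set z | test z j != w j] z)%:E <=
    \int[P w]_z (eta / 4 * #|J|%:R + #|J|%:R * \1_(~` S w) z)%:E)%E.
  apply: ge0_le_integral => //.
  - by move=> z _; rewrite lee_fin sumr_ge0.
  - apply/measurable_EFinP; apply: measurable_sum => j.
    exact: measurable_indic.
  - apply/measurable_EFinP; apply: measurable_funD => //.
    by apply: measurable_funM => //; exact: measurable_indic.
  - by move=> z _; rewrite lee_fin.
under eq_integral do rewrite -sumEFin.
rewrite ge0_integral_sum//; last first.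
  by move=> j; apply/measurable_EFinP; exact: measurable_indic.
rewrite (eq_bigr (fun j => P w [set z | test z j != w j])); last first.
  by move=> j _; rewrite integral_indic ?setIT.
under [leRHS]eq_integral do rewrite EFinD [X in (_ + X)%E]EFinM.
have ei0 : 0 <= eta / 4 * #|J|%:R by rewrite mulr_ge0 ?divr_ge0// ltW.
have m1 : measurable_fun setT (fun z => (\1_(~` S w) z)%:E : \bar R).
  by apply/measurable_EFinP; exact: measurable_indic.
have m2 : measurable_fun setT
    (fun z => #|J|%:R%:E * (\1_(~` S w) z)%:E : \bar R)%E.
  exact: measurable_funeM.
rewrite ge0_integralD//.
rewrite integral_cst// [X in (_ * X + _)%E]probability_setT mule1.
rewrite ge0_integralZl//.
rewrite integral_indic// setIT.
move=> /(le_trans Hw) H.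
have PS : P w (~` S w) \is a fin_num by exact: fin_num_measure.
have {}H : ((eta / 2 * #|J|%:R)%:E <= (eta / 4 * #|J|%:R)%:E +
    #|J|%:R%:E * (fine (P w (~` S w)))%:E)%E by rewrite (fineK PS).
move: H; rewrite -(fineK PS) -EFinM -EFinD !lee_fin => H.
by rewrite -(ler_pM2l J0'); lra.
Qed.

End assouad.

(** * The packing of low-rank matrices *)

Section packing.
Context (R : realType).

Lemma frobenius_sq m1 m2 (A : 'M[R]_(m1, m2)) :
  frobenius A ^+ 2 = \sum_i \sum_j A i j ^+ 2.
Proof.
rewrite sqr_sqrtr// sumr_ge0// => i _; rewrite sumr_ge0// => j _.
exact: sqr_ge0.
Qed.

Lemma frobenius_tr m1 m2 (A : 'M[R]_(m1, m2)) : frobenius A^T = frobenius A.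
Proof.
congr Num.sqrt; rewrite exchange_big; apply: eq_bigr => i _.
by apply: eq_bigr => j _; rewrite mxE.
Qed.

(** Factoring through dimension [r] makes the rank bound immediate. The right factor copies column
    [l] of the bits over a block of [m %/ r] columns and leaves the leftover columns zero. *)
Definition bit_mx M m r (h : R) (w : {ffun 'I_M * 'I_r -> bool}) :
    'M[R]_(M, m) :=
  (\matrix_(i, l) (h * (w (i, l))%:R)) *m
  \matrix_(l < r, j < m) (j %/ (m %/ r) == l)%N%:R.

Lemma bit_mxE M m r h w (i : 'I_M) (j : 'I_m) :
  @bit_mx M m r h w i j =
  if insub (j %/ (m %/ r))%N is Some l then h * (w (i, l))%:R else 0.
Proof.
rewrite mxE; case: insubP => [l lr jl|jr].
  rewrite (bigD1 l)//= !mxE jl eqxx mulr1 big1 ?addr0// => k kl.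
  by rewrite !mxE -jl (inj_eq val_inj) eq_sym (negPf kl) mulr0.
apply: big1 => k _; rewrite !mxE; case: eqP => [jk|_]; last by rewrite mulr0.
by move: jr; rewrite jk ltn_ord.
Qed.

(** Each differing bit contributes [h ^+ 2] in every column of its block. *)
Lemma bit_mx_dist M m r h w w' : (0 < r)%N -> (r <= m)%N ->
  frobenius (@bit_mx M m r h w - bit_mx m h w') ^+ 2 =
  h ^+ 2 * (m %/ r)%:R * (hamming w w')%:R.
Proof.
move=> r0 rm; have K0 : (0 < m %/ r)%N by rewrite divn_gt0.
rewrite frobenius_sq /hamming.
transitivity (\sum_(i < M) \sum_(l < r)
    (h ^+ 2 * (m %/ r)%:R * (w (i, l) != w' (i, l))%:R) : R); last first.
  by rewrite natr_sum big_distrr/= pair_big; apply: eq_bigr => -[].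
apply: eq_bigr => i _.
transitivity (\sum_(j < m) \sum_(l < r | (j %/ (m %/ r) == l)%N)
    (h ^+ 2 * (w (i, l) != w' (i, l))%:R : R)).
  apply: eq_bigr => j _.
  have -> : (bit_mx m h w - bit_mx m h w') i j =
      bit_mx m h w i j - bit_mx m h w' i j.
    by rewrite [LHS]mxE [X in _ + X]mxE.
  rewrite !bit_mxE; case: insubP => [l lr jl|jr].
    rewrite (big_pred1 l) => [|k]; last by rewrite -jl (inj_eq val_inj) eq_sym.
    rewrite -mulrBr exprMn; congr (_ * _).
    by case: (w _); case: (w' _);
      rewrite ?subrr ?subr0 ?sub0r ?sqrrN ?expr0n ?expr1n.
  rewrite big_pred0 ?subr0 ?expr0n// => k; apply/eqP => jk.
  by move: jr; rewrite jk ltn_ord.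
rewrite (exchange_big_dep predT)//=; apply: eq_bigr => l _.
rewrite sumr_const -[LHS]mulr_natr mulrAC; congr (_ * _%:R * _).
set K := (m %/ r)%N in K0 *.
(* Block [l] consists of the columns [l * K + k] with [k < K]; they exist because [r * K <= m]. *)
have lt_m (k : 'I_K) : (l * K + k < m)%N.
  apply: (@leq_trans (l.+1 * K)); first by rewrite mulSnr ltn_add2l.
  by rewrite (leq_trans _ (leq_trunc_div m r))// mulnC leq_mul2l ltn_ord orbT.
pose f k := Ordinal (lt_m k).
have f_inj : injective f by move=> k k' /(congr1 val)/addnI/val_inj.
rewrite -[RHS](card_ord K) -(card_codom f_inj); apply: eq_card => j.
apply/idP/idP => [/eqP jl|/codomP[k ->]]; last first.
  rewrite -[_ \in _]/((l * K + k) %/ K == l)%N.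
  by rewrite divnMDl// divn_small ?addn0.
apply/codomP; exists (Ordinal (ltn_pmod j K0)); apply/val_inj => /=.
by rewrite -jl -divn_eq.
Qed.

(** The bits run along the longer side, hence the transpose when [m1 <= m2]. Differences keep rank
    at most [r] because the right factor is shared. *)
Lemma low_rank_packing m1 m2 r (h : R) : (1 <= r <= minn m1 m2)%N -> 0 <= h ->
  exists A : {ffun 'I_(maxn m1 m2) * 'I_r -> bool} -> 'M[R]_(m1, m2),
  [/\ forall w, (\rank (A w) <= r)%N,
      forall w w', (\rank (A w - A w')%R <= r)%N,
      forall w i j, `|A w i j| <= h &
      forall w w', frobenius (A w - A w') ^+ 2 =
        h ^+ 2 * (minn m1 m2 %/ r)%:R * (hamming w w')%:R].
Proof.
move=> /andP[r1 rm] h0.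
have rk M m w : (\rank (@bit_mx M m r h w) <= r)%N.
  exact: leq_trans (mxrankM_maxr _ _) (rank_leq_row _).
have rkB M m (w w' : {ffun 'I_M * 'I_r -> bool}) :
    (\rank (@bit_mx M m r h w - bit_mx m h w')%R <= r)%N.
  rewrite /bit_mx -mulmxBl.
  exact: leq_trans (mxrankM_maxr _ _) (rank_leq_row _).
have bd M m w i j : `|@bit_mx M m r h w i j| <= h.
  rewrite bit_mxE; case: insubP => [l _ _|_]; last by rewrite normr0.
  by case: (w _); rewrite ?mulr1 ?mulr0 ?normr0// ger0_norm.
case: (leqP m1 m2) rm => [m12|/ltnW m21] rm.
  exists (fun w => (bit_mx m1 h w)^T); split => [w|w w'|w i j|w w'].
  - by rewrite mxrank_tr.
  - by rewrite -linearB/= mxrank_tr.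
  - by rewrite mxE.
  - by rewrite -linearB/= frobenius_tr bit_mx_dist.
exists (fun w => bit_mx m2 h w); split => // w w'.
by rewrite bit_mx_dist.
Qed.

End packing.

(** * The norm of the design *)

Section design_norm.
Context (R : realType) (m1 m2 n : nat).
Implicit Types (A B : 'M[R]_(m1, m2)).
Implicit Types (Pi : 'I_n -> probability 'M[R]_(m1, m2) R).

Lemma measurable_entry (i : 'I_m1) (j : 'I_m2) :
  measurable_fun setT (fun A : 'M[R]_(m1, m2) => A i j).
Proof.
move=> _ Y mY; rewrite setTI; apply: sub_sigma_algebra.
by exists (i, j) => //; exists Y => //; rewrite setTI.
Qed.

Lemma measurable_mx d (T : measurableType d) (f : T -> 'M[R]_(m1, m2)) :
  (forall i j, measurable_fun setT (fun z => f z i j)) -> measurable_fun setT f.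
Proof.
move=> mf _ Y; rewrite setTI.
pose G := [set Y : set 'M[R]_(m1, m2) | measurable (f @^-1` Y)].
suff : @measurable _ 'M[R]_(m1, m2) `<=` G by apply.
apply: smallest_sub.
  split => [|X GX|F GF]; rewrite /G /=.
  - by rewrite preimage_set0.
  - by rewrite setTD preimage_setC; exact: measurableC.
  - by rewrite preimage_bigcup; exact: bigcupT_measurable.
move=> _ [[i j] _ [Z mZ <-]]; rewrite /G /= setTI.
by have := mf i j measurableT Z mZ; rewrite setTI.
Qed.

Lemma mxinnerE A B : mxinner A B = \sum_j \sum_i A i j * B i j.
Proof.
rewrite /mxinner /mxtrace; apply: eq_bigr => j _; rewrite mxE.
by apply: eq_bigr => i _; rewrite mxE.
Qed.

Lemma mxinnerB A B X : mxinner (A - B) X = mxinner A X - mxinner B X.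
Proof. by rewrite /mxinner linearB /= mulmxBl linearB. Qed.

Lemma measurable_mxinner d (T : measurableType d) (f g : T -> 'M[R]_(m1, m2)) :
  measurable_fun setT f -> measurable_fun setT g ->
  measurable_fun setT (fun z => mxinner (f z) (g z)).
Proof.
move=> mf mg; under eq_fun do rewrite mxinnerE.
apply: measurable_sum => j; apply: measurable_sum => i.
by apply: measurable_funM;
  [exact: (measurableT_comp (measurable_entry i j) mf)
  |exact: (measurableT_comp (measurable_entry i j) mg)].
Qed.

Lemma L2Pi_sqnormE Pi A : L2Pi_sqnorm Pi A =
  ((n%:R^-1)%:E * \sum_(i < n) \int[Pi i]_x (mxinner A x ^+ 2)%:E)%E.
Proof.
by rewrite /L2Pi_sqnorm; congr (_ * _)%E; apply: eq_bigr => i _; rewrite unlock.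
Qed.

Lemma L2Pi_sqnorm_ge0 Pi A : (0 <= L2Pi_sqnorm Pi A)%E.
Proof.
rewrite L2Pi_sqnormE mule_ge0 ?lee_fin ?invr_ge0//.
by apply: sume_ge0 => i _; apply: integral_ge0 => x _; rewrite lee_fin sqr_ge0.
Qed.

Lemma measurable_L2Pi_sqnorm Pi : measurable_fun setT (L2Pi_sqnorm Pi).
Proof.
rewrite (_ : L2Pi_sqnorm Pi = fun A => ((n%:R^-1)%:E *
    \sum_(i < n) \int[Pi i]_x (mxinner A x ^+ 2)%:E)%E); last first.
  by apply/funext => A; exact: L2Pi_sqnormE.
apply: measurable_funeM; apply: emeasurable_sum => i.
apply: (@measurable_fun_fubini_tonelli_F _ _ _ _ _ (Pi i)
  (fun z : 'M[R]_(m1, m2) * 'M[R]_(m1, m2) => (mxinner z.1 z.2 ^+ 2)%:E)).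
- apply/measurable_EFinP/measurable_funX.
  exact: measurable_mxinner.
- by move=> z; rewrite lee_fin sqr_ge0.
Qed.

(** Pointwise, the right side minus the left side is the square of [2 <C, x> - <A, x> - <B, x>]. *)
Lemma L2Pi_sqnorm_triangle Pi A B C :
  (L2Pi_sqnorm Pi (A - B) <=
   2%:E * (L2Pi_sqnorm Pi (C - A) + L2Pi_sqnorm Pi (C - B)))%E.
Proof.
have i0 D i : (0 <= \int[Pi i]_x (mxinner D x ^+ 2)%:E)%E.
  by apply: integral_ge0 => x _; rewrite lee_fin sqr_ge0.
have m0 (D : 'M[R]_(m1, m2)) :
      measurable_fun setT (fun x => (mxinner D x ^+ 2)%:E : \bar R).
  apply/measurable_EFinP/measurable_funX.
  exact: (@measurable_mxinner _ _ (fun=> D) id).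
rewrite !L2Pi_sqnormE -ge0_muleDr ?sume_ge0// muleCA.
rewrite lee_wpmul2l ?lee_fin ?invr_ge0//.
rewrite -big_split/= ge0_sume_distrr; last by move=> i _; rewrite adde_ge0.
apply: lee_sum => i _; rewrite -ge0_integralD//; first last.
- by move=> x _; rewrite lee_fin sqr_ge0.
- by move=> x _; rewrite lee_fin sqr_ge0.
rewrite -ge0_integralZl//; first last.
- by move=> x _; rewrite adde_ge0// lee_fin sqr_ge0.
- exact: emeasurable_funD.
apply: ge0_le_integral => //.
- by move=> x _; rewrite lee_fin sqr_ge0.
- by apply: measurable_funeM; exact: emeasurable_funD.
move=> x _; rewrite -EFinD -EFinM lee_fin !mxinnerB -subr_ge0.
rewrite (_ : _ - _ = (2 * mxinner C x - mxinner A x - mxinner B x) ^+ 2).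
  exact: sqr_ge0.
by ring.
Qed.

(** The upper isometry bound excludes an infinite second moment, which allows the passage to real
    squares. *)
Lemma restricted_isometry_sq Pi r mu delta A : 0 < mu -> 0 <= delta < 1 ->
  restricted_isometry Pi r mu delta -> (\rank A <= r)%N ->
  exists q : R, [/\ 0 <= q, L2Pi_sqnorm Pi A = q%:E,
    (1 - delta) ^+ 2 * frobenius A ^+ 2 <= mu ^+ 2 * q &
    mu ^+ 2 * q <= (1 + delta) ^+ 2 * frobenius A ^+ 2].
Proof.
move=> mu0 /andP[d0 d1] /[apply] -[].
rewrite /L2Pi_norm; have := L2Pi_sqnorm_ge0 Pi A.
case: (L2Pi_sqnorm Pi A) => [q||//] /=; last first.
  by rewrite gt0_muley ?lte_fin// leye_eq.
rewrite lee_fin -!EFinM !lee_fin => q0 lb ub; exists q; split => //.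
  rewrite -[q in leRHS]sqr_sqrtr// -!exprMn ler_sqr// nnegrE.
    by rewrite mulr_ge0 ?sqrtr_ge0// subr_ge0 ltW.
  by rewrite mulr_ge0 ?sqrtr_ge0// ltW.
rewrite -[q in leLHS]sqr_sqrtr// -!exprMn ler_sqr// nnegrE.
  by rewrite mulr_ge0 ?sqrtr_ge0// ltW.
by rewrite mulr_ge0 ?sqrtr_ge0// addr_ge0.
Qed.

End design_norm.

(** * The lower bound *)

(** The upper bound is carried through the induction because the step uses that
    [(1 - rho i) * (1 - \prod_(j <- r) rho j)] is nonnegative. *)
Lemma prod_ge_1Bsum (R : realDomainType) (I : Type) (r : seq I)
    (rho e : I -> R) :
  (forall i, 0 <= rho i <= 1) -> (forall i, 0 <= e i) ->
  (forall i, 1 - e i <= rho i) ->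
  1 - \sum_(i <- r) e i <= \prod_(i <- r) rho i <= 1.
Proof.
move=> rho01 e0 erho; elim: r => [|i r /andP[IHl IHu]].
  by rewrite !big_nil subr0 lexx.
rewrite !big_cons.
have p0 : 0 <= \prod_(j <- r) rho j.
  by apply: prodr_ge0 => j _; case/andP: (rho01 j).
have /andP[ri0 ri1] := rho01 i; have := erho i; move=> ei.
apply/andP; split; last by rewrite mulr_ile1.
have : 0 <= (1 - rho i) * (1 - \prod_(j <- r) rho j).
  by rewrite mulr_ge0 ?subr_ge0.
rewrite mulrBr mulr1 mulrBl mul1r; lra.
Qed.

Section trace_regression_test.
Context (R : realType) (m1 m2 n : nat).
Variables (Pi : 'I_n -> probability 'M[R]_(m1, m2) R) (sigma : R).
Hypothesis sigma0 : 0 < sigma.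

Lemma trace_regression_coordinate A (P : probability (sample R m1 m2 n) R) i :
  trace_regression_law Pi A P -> gaussian_noise A sigma P ->
  regression_law (Pi i) sigma (mxinner A)
    (push P (@measurable_tnth _ ('M[R]_(m1, m2) * R)%type n i)).
Proof.
move=> [_ PX _] noiseP B C mB mC.
by have := noiseP i B C mB mC; rewrite PX// => <-.
Qed.

(** Affinities multiply over the independent observations, and each is at least 1 minus the second
    moment of [<A - B, X_i>] over [8 * sigma ^+ 2]; these second moments sum to [n * q]. *)
Lemma trace_regression_affinity A B (P Q : probability (sample R m1 m2 n) R)
    (q : R) :
  trace_regression_law Pi A P -> gaussian_noise A sigma P ->
  trace_regression_law Pi B Q -> gaussian_noise B sigma Q ->
  (0 < n)%N -> L2Pi_sqnorm Pi (A - B) = q%:E ->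
  exists2 rho, 1 - n%:R * q / (8 * sigma ^+ 2) <= rho & affinity_ge P Q rho.
Proof.
move=> PA PG QB QG n0 qE.
have s0 : sigma != 0 by rewrite gt_eqF.
have s8 : 0 < (8 * sigma ^+ 2)^-1 by rewrite invr_gt0 mulr_gt0// exprn_gt0.
have mi (D : 'M[R]_(m1, m2)) : measurable_fun setT (mxinner D).
  exact: (@measurable_mxinner _ _ _ _ _ (fun=> D) id).
pose rho i := regression_affinity (Pi i) sigma (mxinner A) (mxinner B).
pose I i := (\int[Pi i]_x (mxinner (A - B) x ^+ 2)%:E)%E.
have I0 i : (0 <= I i)%E by apply: integral_ge0 => x _; rewrite lee_fin sqr_ge0.
have sumI : (\sum_(i < n) I i = (n%:R * q)%:E)%E.
  move: qE; rewrite L2Pi_sqnormE EFinM => <-.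
  by rewrite muleA -EFinM divff ?mul1e// pnatr_eq0 -lt0n.
have Ifin i : I i \is a fin_num.
  rewrite ge0_fin_numE//.
  apply: (@le_lt_trans _ _ (n%:R * q)%:E); last exact: ltry.
  by rewrite -sumI (bigD1 i)//= leeDl// sume_ge0.
exists (\prod_(i < n) rho i).
  have sumE : \sum_(i < n) fine (I i) = n%:R * q.
    apply: EFin_inj; rewrite -sumI -sumEFin; apply: eq_bigr => i _.
    by rewrite fineK.
  rewrite mulrC -sumE big_distrr/=.
  suff /andP[] : 1 - \sum_(i < n) (8 * sigma ^+ 2)^-1 * fine (I i) <=
    \prod_(i < n) rho i <= 1 by [].
  apply: prod_ge_1Bsum.
  - by move=> i; rewrite regression_affinity_ge0 regression_affinity_le1.
  - by move=> i; rewrite mulr_ge0 ?fine_ge0// ltW.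
  move=> i; have := regression_affinity_lb (Pi i) sigma (mi A) (mi B).
  rewrite (eq_integral (fun x => (mxinner (A - B) x ^+ 2)%:E)); last first.
    by move=> x _; rewrite mxinnerB.
  rewrite -/(I i) -/(rho i) -(fineK (Ifin i)) -EFinM -EFinD lee_fin.
  by rewrite lerBlDr.
apply: affinity_tuple.
- by move=> i; exact: regression_affinity_ge0.
- by case: PA.
- by case: QB.
move=> i.
have PQ := affinity_regression s0 (mi A) (mi B)
  (@trace_regression_coordinate _ _ i PA PG)
  (@trace_regression_coordinate _ _ i QB QG).
exact: PQ.
Qed.

End trace_regression_test.

Theorem theorem5 (R : realType) :
  exists beta c : R, [/\ 0 < beta < 1, 0 < c &
    forall (m1 m2 n r : nat) (a sigma mu delta : R)
      (Pi : 'I_n -> probability 'M[R]_(m1, m2) R)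
      (P : 'M[R]_(m1, m2) -> probability (sample R m1 m2 n) R),
      0 < a -> 0 < sigma -> (1 <= r <= minn m1 m2)%N ->
      0 < mu -> 0 <= delta < 1 ->
      restricted_isometry Pi r mu delta ->
      mu ^+ 2 * r%:R <= n%:R * (minn m1 m2)%:R ->
      (forall A0, trace_regression_law Pi A0 (P A0)) ->
      (forall A0, gaussian_noise A0 sigma (P A0)) ->
      (beta%:E <=
       ereal_inf [set ereal_sup
           [set P A0 [set z |
                (c * (1 - delta) ^+ 2 * Num.min sigma a ^+ 2 *
                   ((maxn m1 m2)%:R * r%:R / n%:R))%:E
                < L2Pi_sqnorm Pi (Ahat z - A0)%R]
           | A0 in matrix_class r a]
         | Ahat in @estimator R m1 m2 n])%E].
Proof.
(* Affinity 1/2 and test parameter 1/4 give [eta = 1/8], and [beta] is [eta / 4]. Two vertices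
   within the threshold of one estimate differ in at most [8 c M r] bits, which must be at most
   [eta / 4 * M * r]; this fixes [c]. *)
exists (1 / 32), (1 / 256); split; [lra|lra|].
move=> m1 m2 n r a sigma mu delta Pi P a0 s0 rm mu0 d01 RIP mur law noise.
have /andP[r1 rle] := rm.
set m := minn m1 m2 in rm rle mur *; set M := maxn m1 m2.
set b := Num.min sigma a.
have b0 : 0 < b by rewrite lt_min s0.
have m0 : (0 < m)%N by exact: leq_trans rle.
have rR0 : 0 < r%:R :> R by rewrite ltr0n.
have mR0 : 0 < m%:R :> R by rewrite ltr0n.
have n0 : (0 < n)%N.
  rewrite lt0n; apply: contraTneq mur => ->; rewrite mul0r -ltNge.
  by rewrite mulr_gt0// exprn_gt0.
have nR0 : 0 < n%:R :> R by rewrite ltr0n.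
have M0 : (0 < M)%N by rewrite (leq_trans m0)// geq_min leq_max leqnn.
pose K : nat := (m %/ r)%N.
have Kr : (K * r)%:R <= m%:R :> R by rewrite ler_nat leq_trunc_div.
(* The remainder of [m] modulo [r] is below [r <= K * r], so rounding the block size down costs at
   most a factor 2; this is the bound [1 / 2 <= u] below. *)
have K2r : m%:R <= 2 * (K * r)%:R :> R.
  rewrite -natrM ler_nat {1}(divn_eq m r) -/K mul2n -addnn leq_add2l.
  rewrite (leq_trans (ltnW (ltn_pmod m r1)))// leq_pmull//.
  by rewrite divn_gt0.
(* The assumption on [mu] gives [h2 <= b ^+ 2], so the entries stay below [a]; and one bit has
   squared Frobenius weight [h2 * K = g * u], of order [b ^+ 2 * mu ^+ 2 / n]. *)
pose h2 := b ^+ 2 * (mu ^+ 2 * r%:R / (n%:R * m%:R)).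
have q0 : 0 <= mu ^+ 2 * r%:R / (n%:R * m%:R).
  by apply: divr_ge0; apply: mulr_ge0; rewrite ?sqr_ge0 ?ler0n.
have q1 : mu ^+ 2 * r%:R / (n%:R * m%:R) <= 1.
  by rewrite ler_pdivrMr ?mulr_gt0// mul1r.
have h20 : 0 <= h2 by rewrite mulr_ge0 ?sqr_ge0.
pose g := b ^+ 2 * mu ^+ 2 / n%:R.
have g0 : 0 < g by rewrite divr_gt0// mulr_gt0// exprn_gt0.
pose u : R := (K * r)%:R / m%:R.
have u1 : u <= 1 by rewrite ler_pdivrMr// mul1r.
have u2 : 1 / 2 <= u by rewrite ler_pdivlMr//; lra.
have hK : h2 * K%:R = g * u.
  by rewrite /h2 /g /u natrM; field; rewrite !gt_eqF.
pose h := Num.sqrt h2.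
have hh : h ^+ 2 = h2 by rewrite sqr_sqrtr.
have h_le_b : h <= b.
  rewrite -ler_sqr ?nnegrE ?sqrtr_ge0 ?(ltW b0)// hh.
  by rewrite ler_piMr ?sqr_ge0.
have [A [rkA rkAB bdA distA]] := low_rank_packing rm (sqrtr_ge0 h2).
rewrite -/h -/m -/K in distA.
set J : finType := ('I_(maxn m1 m2) * 'I_r)%type in A rkA rkAB bdA distA *.
have cardJ : #|J| = (M * r)%N by rewrite card_prod !card_ord.
(* For one flipped bit, [(1 + delta) ^+ 2 <= 4] and [u <= 1] give
   [n * q <= 4 * b ^+ 2 <= 4 * sigma ^+ 2], hence an affinity of at least 1/2. *)
have test w j E : measurable E ->
    ((1 / 8)%:E <= P (A w) E + P (A (flip j w)) (~` E))%E.
  move=> mE.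
  have [q [q_ge0 qE _ ub]] :=
    restricted_isometry_sq mu0 d01 RIP (rkAB w (flip j w)).
  have [rho rho_ge PQ] := trace_regression_affinity s0 (law _) (noise _)
    (law _) (noise _) n0 qE.
  have e0 : 0 < 1 / 4 :> R by lra.
  apply: le_trans (affinity_test e0 mE PQ); rewrite lee_fin.
  suff : n%:R * q / (8 * sigma ^+ 2) <= 1 / 2 by nra.
  move: ub; rewrite distA hamming_flip mulr1 hh hK => ub.
  have {}ub : mu ^+ 2 * (n%:R * q) <= mu ^+ 2 * (4 * b ^+ 2).
    rewrite (_ : mu ^+ 2 * (4 * b ^+ 2) = n%:R * (4 * g)); last first.
      by rewrite /g; field; rewrite gt_eqF.
    rewrite mulrCA ler_pM2l// (le_trans ub)//.
    apply: ler_pM; first exact: sqr_ge0.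
    - by apply: mulr_ge0; lra.
    - by case/andP: d01 => ? ?; nra.
    - by rewrite ler_piMr// ltW.
  have {}ub : n%:R * q <= 4 * b ^+ 2 by rewrite ler_pM2l ?exprn_gt0 in ub.
  have bs : b ^+ 2 <= sigma ^+ 2.
    by rewrite ler_sqr ?nnegrE ?(ltW b0) ?(ltW s0)// ge_min lexx.
  rewrite ler_pdivrMr ?mulr_gt0 ?exprn_gt0//; lra.
apply/le_ereal_inf_tmp => _ [Ahat mAhat <-].
set thr : R := _ * _ * _ * _.
pose S w := [set z | (L2Pi_sqnorm Pi (Ahat z - A w)%R <= thr%:E)%E].
have mL w : measurable_fun setT (fun z => L2Pi_sqnorm Pi (Ahat z - A w)%R).
  apply: (measurableT_comp (measurable_L2Pi_sqnorm Pi)).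
  apply: measurable_mx => i j; under eq_fun do rewrite mxE [X in _ + X]mxE.
  apply: measurable_funB => //.
  exact: (measurableT_comp (measurable_entry i j) mAhat).
have mS w : measurable (S w).
  rewrite -[S w]setTI; exact: emeasurable_fun_infty_c.
(* The triangle inequality gives [q <= 4 * thr], while the lower isometry bound and [1 / 2 <= u]
   make [mu ^+ 2 * q] at least [(1 - delta) ^+ 2 * g / 2] times the Hamming distance. *)
have close z w w' : S w z -> S w' z ->
    (hamming w w')%:R <= 1 / 8 / 4 * #|J|%:R :> R.
  rewrite /S /= => zw zw'.
  have [q [q_ge0 qE lb _]] := restricted_isometry_sq mu0 d01 RIP (rkAB w w').
  have : (q%:E <= 2%:E * (thr%:E + thr%:E))%E.
    rewrite -qE (le_trans (L2Pi_sqnorm_triangle _ _ _ (Ahat z)))//.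
    by rewrite lee_wpmul2l ?lee_fin// leeD.
  rewrite -EFinD -EFinM lee_fin => q_le.
  move: lb; rewrite distA hh hK => lb.
  have D0 : 0 < (1 - delta) ^+ 2 * g.
    by rewrite mulr_gt0// exprn_gt0// subr_gt0; case/andP: d01.
  rewrite cardJ natrM.
  have thrE : mu ^+ 2 * thr = (1 - delta) ^+ 2 * g * (M%:R * r%:R / 256).
    by rewrite /thr /g -/b -/M; field; rewrite gt_eqF.
  have mu20 : 0 <= mu ^+ 2 by exact: sqr_ge0.
  rewrite -(ler_pM2l D0).
  have : mu ^+ 2 * q <= 4 * (mu ^+ 2 * thr) by nra.
  have : (1 - delta) ^+ 2 * g * (hamming w w')%:R * (1 / 2) <=
      (1 - delta) ^+ 2 * (g * u * (hamming w w')%:R).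
    rewrite (_ : (1 - delta) ^+ 2 * (g * u * (hamming w w')%:R) =
      (1 - delta) ^+ 2 * g * (hamming w w')%:R * u); last by ring.
    by rewrite ler_wpM2l// mulr_ge0// ltW.
  by rewrite thrE; lra.
have J0 : (0 < #|J|)%N by rewrite cardJ muln_gt0 M0.
have e0 : 0 < 1 / 8 :> R by lra.
have [w Pw] := assouad_cover e0 J0 mS close test.
apply: le_trans (_ : _ <= P (A w) (~` S w))%E _.
  by apply: le_trans Pw; rewrite lee_fin; lra.
apply: ereal_sup_ubound; exists (A w).
  split => // i j; apply: le_trans (bdA w i j) _.
  by apply: (le_trans h_le_b); rewrite ge_min lexx orbT.
congr (P _ _); apply/seteqP; split => z /=; rewrite /S /= ltNge.
  by move/negP.
by move=> H; apply/negP.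
Qed.
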